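(* Let $G=(V,E,\mu,\omega)$ be a connected weighted graph with Laplacian $\Delta$, let $p\in V$, and let $a:V\to\mathbb R$ be a function. Assume that for some constant $D>0$, $$\sup_{x\in V}\mathrm{Deg}(x)\leq D.$$ Then the following two statements are equivalent. (i) There exist constants $\delta>0$, $A_1>0$ and $0<A_2<1$ such that the Cauchy problem for the backward heat equation $$\partial_t u+\Delta u=0,\qquad u(x,0)=a(x),$$ has a solution $u$ on $V\times[0,\delta)$ satisfying $$|u(x,t)|\leq A_1e^{A_2\,d(x,p)\ln d(x,p)}\qquad\text{for all }(x,t)\in V\times[0,\delta).$$ (ii) There exist constants $A_3>0$ and $0<A_4<1$ such that $$|\Delta^k a(x)|\leq A_3(2D)^k e^{A_4\,(k+d(x,p))\ln(k+d(x,p))}\qquad\text{for all }x\in V,\ k=0,1,2,\dots$$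
   Context: A weighted graph $G=(V,E,\mu,\omega)$ consists of a locally finite, simple, undirected graph $(V,E)$, a vertex weight $\mu:V\to(0,\infty)$, $x\mapsto\mu_x$, and a symmetric edge weight $\omega:E\to(0,\infty)$, $\{x,y\}\mapsto\omega_{xy}=\omega_{yx}$, extended to $V\times V$ by $\omega_{xy}=0$ if $\{x,y\}\notin E$. Write $x\sim y$ if $\{x,y\}\in E$. For $f:V\to\mathbb R$, the Laplacian is $\Delta f(x)=\sum_{y\in V}\frac{\omega_{xy}}{\mu_x}(f(y)-f(x))$, and $\Delta^k$ is its $k$-fold iterate ($\Delta^0 f=f$). The weighted degree is $\mathrm{Deg}(x)=\sum_{y\in V}\frac{\omega_{xy}}{\mu_x}$. The combinatorial distance is $d(x,y)=\inf\{n: x=z_0\sim z_1\sim\cdots\sim z_n=y\}$; the graph is connected, so $d$ is finite. Convention: $0\ln 0=0$. For $u:V\times[0,\delta)\to\mathbb R$, $\Delta$ acts in the variable $x$, and the equation is required for all $x\in V$ and $t\in[0,\delta)$, with the one-sided time derivative at $t=0$. *)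

(* Defs.v *)
From HB Require Import structures.
From mathcomp Require Import all_boot all_order all_algebra.
From mathcomp Require Import all_classical all_reals all_analysis.
Import Order.TTheory GRing.Theory Num.Theory.
Import numFieldNormedType.Exports.

Local Open Scope classical_set_scope.
Local Open Scope ring_scope.

(* The edge set E is given by the symmetric irreflexive relation adj, and the
   edge weight is already extended by 0 to V x V. *)
Record weightedGraph (R : realType) (V : choiceType) := WeightedGraph {
  adj : rel V;
  adj_sym : forall x y, adj x y = adj y x;
  adj_irrefl : forall x, ~~ adj x x;
  adj_locally_finite : forall x, finite_set [set y | adj x y];
  vweight : V -> R;
  vweight_gt0 : forall x, 0 < vweight x;
  eweight : V -> V -> R;
  eweight_sym : forall x y, eweight x y = eweight y x;
  eweight_gt0 : forall x y, adj x y -> 0 < eweight x y;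
  eweight_eq0 : forall x y, ~~ adj x y -> eweight x y = 0
}.

Arguments adj {R V}.
Arguments vweight {R V}.
Arguments eweight {R V}.

(* Sums over [set: V] range over the support of the summand, which lies in the
   finite neighbourhood of x. *)
Definition laplacian {R : realType} {V : choiceType} (G : weightedGraph R V)
    (f : V -> R) (x : V) : R :=
  \sum_(y \in [set: V]) eweight G x y / vweight G x * (f y - f x).

Definition wdeg {R : realType} {V : choiceType} (G : weightedGraph R V)
    (x : V) : R :=
  \sum_(y \in [set: V]) eweight G x y / vweight G x.

Definition walk {R : realType} {V : choiceType} (G : weightedGraph R V)
    (x y : V) (s : seq V) : Prop :=
  path (adj G) x s /\ last x s = y.

Definition graph_connected {R : realType} {V : choiceType}
    (G : weightedGraph R V) : Prop :=
  forall x y, exists s, walk G x y s.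

(* The infimum is over a nonempty set of naturals as soon as x and y are joined
   by a walk; otherwise inf returns the junk value 0. *)
Definition gdist {R : realType} {V : choiceType} (G : weightedGraph R V)
    (x y : V) : R :=
  inf [set (size s)%:R | s in [set s | walk G x y s]].

(* l is the derivative of f at t, one-sided at t = 0. *)
Definition is_time_derive {R : realType} (f : R -> R) (t l : R) : Prop :=
  if t == 0 then (h^-1 * (f h - f 0)) @[h --> (0 : R)^'+] --> l
  else is_derive t 1 f l.

(* Only the values of u on V x [0, delta) matter. *)
Definition backward_heat_solution {R : realType} {V : choiceType}
    (G : weightedGraph R V) (a : V -> R) (delta : R) (u : V -> R -> R) : Prop :=
  (forall x, u x 0 = a x) /\
  (forall x t, 0 <= t < delta ->
     exists2 dtu, is_time_derive (u x) t dtu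
                & dtu + laplacian G (fun y => u y t) x = 0).

(* Main.v *)
(* (i) => (ii): at a vertex, |Δf| is at most 2D times the maximum of |f| over
   the ball of radius 1, so |Δ^k a(x)| is controlled by the bound on a = u(., 0)
   at distance k + d(x,p).
   (ii) => (i): u(x,t) = Σ_k (-t)^k Δ^k a(x) / k!. Convexity of s ln s gives
   (k+d) ln (k+d) <= k ln k + d ln d + (k+d) ln 2, and k ln k <= ln k! + k, so the
   coefficients are bounded by C(x) M^k with M independent of x and
   C(x) = A_3 exp (d ln 2 + A_4 d ln d); the factor 2^d is absorbed by enlarging
   A_4 to (1 + A_4) / 2. *)
Require Import Defs.
From mathcomp Require Import all_boot all_order all_algebra.
From mathcomp Require Import all_classical all_reals all_analysis.
From mathcomp Require Import ring lra zify.
Import Order.TTheory GRing.Theory Num.Theory.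
Import numFieldNormedType.Exports.

Set Implicit Arguments.
Unset Strict Implicit.
Unset Printing Implicit Defensive.

Local Open Scope classical_set_scope.
Local Open Scope ring_scope.

(** * Estimates for n ln n *)

Lemma xlnx_ge0 (R : realType) (n : nat) : 0 <= n%:R * ln n%:R :> R.
Proof.
case: n => [|n]; first by rewrite mul0r.
by apply: mulr_ge0 => //; apply: ln_ge0; rewrite ler1n.
Qed.

Lemma xlnx_nondecreasing (R : realType) (m n : nat) :
  (m <= n)%N -> m%:R * ln m%:R <= n%:R * ln n%:R :> R.
Proof.
(* At m = 0 the product vanishes whatever value [ln] takes there. *)
case: m => [|m] mn; first by rewrite mul0r xlnx_ge0.
apply: ler_pM; rewrite ?ler_nat ?ln_ge0 ?ler1n//.
by rewrite ler_ln ?posrE ?ltr0n ?ler_nat// (leq_trans _ mn).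
Qed.

(* Convexity of [x ln x], by [ln y <= y - 1] at [y = (m + n) / (2 m)]. *)
Lemma xlnx_addn (R : realType) (m n : nat) :
  (m + n)%:R * ln (m + n)%:R <=
    m%:R * ln m%:R + n%:R * ln n%:R + (m + n)%:R * ln 2 :> R.
Proof.
have tangent (k l : nat) :
    k%:R * ln (k + l)%:R <= k%:R * ln k%:R + k%:R * ln 2 + (l%:R - k%:R) / 2 :> R.
  have l0 : 0 <= l%:R :> R by [].
  case: k => [|k]; first by rewrite !mul0r; lra.
  have k0 : 0 < k.+1%:R :> R by rewrite ltr0n.
  have kl0 : 0 < (k.+1 + l)%:R :> R by rewrite ltr0n.
  set y : R := (k.+1 + l)%:R / (k.+1%:R * 2).
  have y0 : 0 < y by rewrite divr_gt0// mulr_gt0.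
  have -> : (k.+1 + l)%:R = k.+1%:R * 2 * y :> R.
    by rewrite /y; field; rewrite gt_eqF.
  rewrite lnM ?posrE ?mulr_gt0// lnM ?posrE//.
  have lny : ln y <= y - 1.
    by have := @le_ln1Dx _ (y - 1); rewrite [1 + _]addrC subrK; apply; lra.
  have : k.+1%:R * ln y <= k.+1%:R * (y - 1) by rewrite ler_pM2l.
  have -> : k.+1%:R * (y - 1) = (l%:R - k.+1%:R) / 2.
    by rewrite /y natrD; field; rewrite gt_eqF.
  lra.
(* Adding the bounds for (m, n) and (n, m) cancels the terms (l - k) / 2. *)
have := tangent m n; have := tangent n m; rewrite [in ln (n + m)%:R]addnC natrD.
lra.
Qed.

(** A weak Stirling bound by induction: n ln (n + 1) exceeds n ln n by n ln (1 + 1/n), which is at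
    most 1. *)
Lemma xlnx_le_lnfact (R : realType) (n : nat) :
  n%:R * ln n%:R <= ln n`!%:R + n%:R :> R.
Proof.
elim: n => [|n IH]; first by rewrite mul0r fact0 ln1 addr0.
rewrite factS natrM lnM ?posrE ?ltr0n ?fact_gt0//.
suff : n%:R * ln n.+1%:R <= n%:R * ln n%:R + 1 :> R.
  by rewrite -natr1 mulrDl mul1r; lra.
case: n {IH} => [|n]; first by rewrite !mul0r add0r.
have n0 : 0 < n.+1%:R :> R by rewrite ltr0n.
have -> : n.+2%:R = n.+1%:R * (1 + n.+1%:R^-1) :> R.
  by rewrite -[in LHS]natr1; field; rewrite gt_eqF.
have n1 : 0 < n.+1%:R^-1 :> R by rewrite invr_gt0.
rewrite lnM ?posrE ?addr_gt0// mulrDr lerD2l.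
rewrite -[leRHS](@divff _ n.+1%:R) ?gt_eqF// ler_pM2l// le_ln1Dx//.
by rewrite (lt_trans _ n1).
Qed.

(** Below the threshold n = exp (c / e) the constant dominates; above it ln n >= c / e. This absorbs
    an exponential factor in the distance into a slightly larger multiple of n ln n. *)
Lemma linear_le_xlnx (R : realType) (c e : R) (n : nat) : 0 < e -> 0 <= c ->
  c * n%:R <= c * expR (c / e) + e * (n%:R * ln n%:R).
Proof.
move=> e0 c0; have nln := xlnx_ge0 R n.
have [ce|ce] := leP n%:R (expR (c / e)).
  by rewrite ler_wpDr ?ler_wpM2l// mulr_ge0// ltW.
rewrite ler_wpDl ?mulr_ge0 ?expR_ge0//.
rewrite [c * _]mulrC mulrCA ler_wpM2l// mulrC -ler_pdivrMr//.
by rewrite -[c / e]expRK ler_ln ?posrE ?expR_gt0 ?ltW// (lt_trans _ ce) ?expR_gt0.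
Qed.

(** After the convexity bound, A < 1 is used to drop A from the terms k ln k and (k + n) ln 2, while
    n ln n must keep it. The k-part is then k! times a geometric factor. *)
Lemma expR_xlnx_addn_le (R : realType) (A : R) (k n : nat) : 0 < A < 1 ->
  expR (A * ((k + n)%:R * ln (k + n)%:R)) <=
    expR (ln 2 * n%:R + A * (n%:R * ln n%:R)) * expR (1 + ln 2) ^+ k * k`!%:R :> R.
Proof.
move=> /andP[A0 A1]; have kfact : 0 < k`!%:R :> R by rewrite ltr0n fact_gt0.
rewrite -[k`!%:R]lnK ?posrE// -expRM_natr -!expRD ler_expR.
have := xlnx_addn R k n; have := xlnx_le_lnfact R k; have := xlnx_ge0 R k.
have : 0 <= ln 2 :> R by rewrite ln_ge0// ler1n.
have k0 : 0 <= k%:R :> R by [].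
have n0 : 0 <= n%:R :> R by [].
rewrite natrD.
set x : R := k%:R; set y : R := n%:R; set L : R := ln 2; set F : R := ln k`!%:R.
set X := x * ln x; set Y := y * ln y; set S := (x + y) * ln (x + y).
move=> L0 X0 XF SXY.
have : A * S <= A * (X + Y + (x + y) * L) by rewrite ler_pM2l.
have : A * X <= X by rewrite ler_piMl// ltW.
have : A * ((x + y) * L) <= (x + y) * L.
  by rewrite (ler_piMl _ (ltW A1))// mulr_ge0// addr_ge0.
lra.
Qed.

(** * Power series with geometrically bounded coefficients *)

(** Since k + 1 <= 2^k, formal differentiation keeps the bound geometric and doubles the ratio. *)
Lemma pseries_diffs_geometric_bound (R : realType) (b : R^nat) (C M : R) :
  0 <= C -> 0 <= M -> (forall k, `|b k| <= C * M ^+ k) ->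
  forall k, `|pseries_diffs b k| <= C * M * (2 * M) ^+ k.
Proof.
move=> C0 M0 bCM k; rewrite /pseries_diffs normrM ger0_norm//.
have -> : C * M * (2 * M) ^+ k = 2 ^+ k * (C * M ^+ k.+1).
  by rewrite exprMn exprS; ring.
apply: ler_pM => //.
by rewrite -natrX ler_nat; elim: k => // k; rewrite expnS; lia.
Qed.

(** Comparison with the geometric series of ratio 1/2, whose sum is 2C. *)
Lemma cvg_pseries_geometric_bound (R : realType) (b : R^nat) (C M t : R) :
  0 <= C -> 0 <= M -> (forall k, `|b k| <= C * M ^+ k) -> M * `|t| <= 2^-1 ->
  cvgn (pseries b t) /\ `|limn (pseries b t)| <= 2 * C.
Proof.
move=> C0 M0 bCM Mt.
have half : `|2^-1 : R| < 1 by rewrite ger0_norm//; lra.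
have geom := @cvg_geometric_series _ C _ half.
have cvg_geom : cvgn (series (geometric C 2^-1)).
  by apply/cvg_ex; eexists; exact: geom.
have le_geom k : `|b k * t ^+ k| <= geometric C 2^-1 k.
  rewrite normrM normrX /geometric /=.
  apply: (le_trans (ler_wpM2r (exprn_ge0 _ (normr_ge0 t)) (bCM k))).
  by rewrite -mulrA -exprMn ler_wpM2l// lerXn2r// ?nnegrE ?mulr_ge0.
have cvgb : cvgn [normed series (fun k => b k * t ^+ k)].
  apply: (@series_le_cvg _ _ (geometric C 2^-1)) => //.
  - by move=> k; exact: normr_ge0.
  - by move=> k; rewrite mulr_ge0// exprn_ge0.
split; first exact: normed_cvg.
apply: (le_trans (lim_series_norm cvgb)).
apply: (le_trans (lim_series_le cvgb cvg_geom le_geom)).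
rewrite (cvg_lim _ geom)// (_ : 1 - 2^-1 = 2^-1); last by field.
by rewrite invrK mulrC.
Qed.

Lemma is_derive_pseries (R : realType) (b : R^nat) (C M t : R) :
  0 <= C -> 0 < M -> (forall k, `|b k| <= C * M ^+ k) -> `|t| < (8 * M)^-1 ->
  is_derive t 1 (fun s => limn (pseries b s)) (limn (pseries (pseries_diffs b) t)).
Proof.
move=> C0 M0 bCM tM; have M0' := ltW M0.
have K0 : 0 < (8 * M)^-1 by rewrite invr_gt0 mulr_gt0.
have bCM1 := pseries_diffs_geometric_bound C0 M0' bCM.
have CM0 : 0 <= C * M by rewrite mulr_ge0.
have twoM0 : 0 <= 2 * M by rewrite mulr_ge0.
have bCM2 := pseries_diffs_geometric_bound CM0 twoM0 bCM1.
have MK : M * (8 * M)^-1 = 8^-1 by field; rewrite gt_eqF.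
(* Convergence at 1 / (8M) is required of the series and of its first two formal derivatives. Their
   ratios M, 2M, 4M give 1/8, 1/4, 1/2 there, the last being the largest value that the comparison
   admits. *)
apply: (@pseries_snd_diffs _ _ (8 * M)^-1); last by rewrite (gtr0_norm K0).
- apply: (cvg_pseries_geometric_bound _ _ bCM _).1 => //.
  by rewrite (gtr0_norm K0) MK; lra.
- apply: (cvg_pseries_geometric_bound _ _ bCM1 _).1; rewrite ?mulr_ge0//.
  by rewrite (gtr0_norm K0) -mulrA MK; lra.
- apply: (cvg_pseries_geometric_bound _ _ bCM2 _).1; rewrite ?mulr_ge0//.
  by rewrite (gtr0_norm K0) -!mulrA MK; lra.
Qed.

(** At t = 0 the two-sided limit of the difference quotient restricts to the right. *)
Lemma is_derive_time (R : realType) (f : R -> R) (t l : R) :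
  is_derive t 1 f l -> is_time_derive f t l.
Proof.
rewrite /is_time_derive; case: eqVneq => // -> [df <-].
move: df; rewrite /derivable /derive => /cvg_ex[l' f'l'].
rewrite (cvg_lim _ f'l')//.
move: f'l' => /cvg_dnbhs_at_right; apply: cvg_trans.
suff -> : (fun h => h^-1 * (f h - f 0)) =
  (fun h => h^-1 *: ((f \o shift 0) (h *: 1) - f 0)) by [].
by apply/funext => h; rewrite /= addr0 /GRing.scale /= mulr1.
Qed.

(** * The Laplacian as a finite sum *)

Definition neighbours {R : realType} {V : choiceType} (G : weightedGraph R V)
  (x : V) : seq V := finmap.enum_fset (fset_set [set y | adj G x y]).

Lemma mem_neighbours {R : realType} {V : choiceType} (G : weightedGraph R V)
  (x y : V) : (y \in neighbours G x) = adj G x y.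
Proof.
rewrite [LHS](in_fset_set (adj_locally_finite _ _ G x)).
by apply/idP/idP; rewrite inE.
Qed.

(** The index list no longer depends on the support of the summand, so sums for different functions
    can be added, compared and passed to the limit. *)
Lemma fsum_neighbours {R : realType} {V : choiceType} (G : weightedGraph R V)
    (x : V) (F : V -> R) : (forall y, ~~ adj G x y -> F y = 0) ->
  \sum_(y \in [set: V]) F y = \sum_(y <- neighbours G x) F y.
Proof.
move=> F0; rewrite (@fsbigE _ _ _ _ _ (neighbours G x))//.
- by apply: eq_bigl => y; rewrite in_setT.
- exact: finmap.fset_uniq.
- by move=> y _; rewrite mem_neighbours; exact: F0.
Qed.

Lemma laplacianE (R : realType) (V : choiceType) (G : weightedGraph R V)
    (f : V -> R) (x : V) :
  laplacian G f x =
    \sum_(y <- neighbours G x) eweight G x y / vweight G x * (f y - f x).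
Proof.
by apply: fsum_neighbours => y xy; rewrite eweight_eq0// !mul0r.
Qed.

Lemma wdegE (R : realType) (V : choiceType) (G : weightedGraph R V) (x : V) :
  wdeg G x = \sum_(y <- neighbours G x) eweight G x y / vweight G x.
Proof.
by apply: fsum_neighbours => y xy; rewrite eweight_eq0// !mul0r.
Qed.

Lemma laplacian_bound (R : realType) (V : choiceType) (G : weightedGraph R V)
    (f : V -> R) (x : V) (D M : R) :
  wdeg G x <= D -> `|f x| <= M -> (forall y, adj G x y -> `|f y| <= M) ->
  `|laplacian G f x| <= 2 * D * M.
Proof.
move=> degD fx fy; have M0 : 0 <= M by apply: le_trans fx.
apply: (@le_trans _ _ (wdeg G x * (2 * M))); last first.
  by have := ler_wpM2r (mulr_ge0 (ler0n R 2) M0) degD; lra.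
rewrite laplacianE wdegE mulr_suml; apply: (le_trans (ler_norm_sum _ _ _)).
rewrite big_seq [leRHS]big_seq; apply: ler_sum => y.
rewrite mem_neighbours => xy.
have w0 : 0 < eweight G x y / vweight G x.
  by rewrite divr_gt0// ?eweight_gt0 ?vweight_gt0.
rewrite normrM (gtr0_norm w0) ler_pM2l//.
apply: (le_trans (ler_normB _ _)); have := fy y xy; lra.
Qed.

Lemma laplacian_sum (R : realType) (V : choiceType) (G : weightedGraph R V)
    (I : Type) (r : seq I) (c : I -> R) (g : I -> V -> R) (x : V) :
  laplacian G (fun y => \sum_(i <- r) c i * g i y) x =
    \sum_(i <- r) c i * laplacian G (g i) x.
Proof.
rewrite laplacianE.
under [RHS]eq_bigr do rewrite laplacianE mulr_sumr.
rewrite exchange_big /=; apply: eq_bigr => y _.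
rewrite -sumrB mulr_sumr; apply: eq_bigr => i _; ring.
Qed.

(** By local finiteness pointwise convergence suffices. *)
Lemma laplacian_cvg (R : realType) (V : choiceType) (G : weightedGraph R V)
    (f : nat -> V -> R) (g : V -> R) (x : V) :
  (forall y, f n y @[n --> \oo] --> g y) ->
  laplacian G (f n) x @[n --> \oo] --> laplacian G g x.
Proof.
move=> fg; rewrite laplacianE; under eq_fun do rewrite laplacianE.
apply: cvg_big => [|y _]; first exact: add_continuous.
by apply: cvgM; [exact: cvg_cst|apply: cvgB].
Qed.

(** * Distance to p and iterated Laplacians *)

Lemma gdist_nat (R : realType) (V : choiceType) (G : weightedGraph R V)
    (x y : V) (s : seq V) : walk G x y s ->
  exists n, [/\ gdist G x y = n%:R, exists2 s, walk G x y s & size s = n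
    & forall s, walk G x y s -> (n <= size s)%N].
Proof.
move=> xys.
have ex_n : exists n, `[< exists2 s, walk G x y s & size s = n >].
  by exists (size s); apply/asboolP; exists s.
case: (ex_minnP ex_n) => n /asboolP[s' xys' sn] nmin.
have {}nmin s'' : walk G x y s'' -> (n <= size s'')%N.
  by move=> w; apply: nmin; apply/asboolP; exists s''.
exists n; split=> //; last by exists s'.
have nlb : lbound [set (size s)%:R | s in [set s | walk G x y s]] (n%:R : R).
  by move=> _ [s'' w <-]; rewrite ler_nat nmin.
apply/eqP; rewrite eq_le; apply/andP; split.
  by apply: ge_inf; [exists n%:R|exists s'; rewrite ?sn].
by apply: lb_le_inf => //; exists (size s)%:R; exists s.
Qed.

(** Prefixing x to a shortest walk from x to p gives a walk from its neighbour y. *)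
Lemma gdist_natfun (R : realType) (V : choiceType) (G : weightedGraph R V)
    (p : V) : graph_connected G ->
  exists N : V -> nat, (forall x, gdist G x p = (N x)%:R) /\
    (forall x y, adj G x y -> (N y <= (N x).+1)%N).
Proof.
move=> Gc; have /choice[N NP] := fun x =>
  let: ex_intro s w := Gc x p in gdist_nat w.
exists N; split=> [x|x y xy]; first by have [] := NP x.
have [_ [s [ps ls] <-] _] := NP x; have [_ _ Ny] := NP y.
by apply: (Ny (x :: s)); split=> //=; rewrite adj_sym xy.
Qed.

(** Each Laplacian costs a factor 2D and one step of distance, which raises the argument of F by
    one. *)
Lemma iter_laplacian_bound (R : realType) (V : choiceType)
    (G : weightedGraph R V) (D : R) (N : V -> nat) (F : nat -> R) (f : V -> R) :
  0 <= D -> (forall x, wdeg G x <= D) ->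
  (forall x y, adj G x y -> (N y <= (N x).+1)%N) ->
  {homo F : m n / (m <= n)%N >-> m <= n} -> (forall x, `|f x| <= F (N x)) ->
  forall k x, `|iter k (laplacian G) f x| <= (2 * D) ^+ k * F (k + N x)%N.
Proof.
move=> D0 degD Nadj Fmono fF; elim=> [|k IH] x; first by rewrite mul1r.
rewrite iterS exprS -mulrA; apply: laplacian_bound => // [|y xy].
  apply: (le_trans (IH x)).
  by rewrite ler_wpM2l ?exprn_ge0 ?mulr_ge0// Fmono// addSn.
apply: (le_trans (IH y)); rewrite ler_wpM2l ?exprn_ge0 ?mulr_ge0// Fmono//.
by rewrite addSnnS leq_add2l; exact: Nadj.
Qed.

(** * The power series solution *)

(** Taylor coefficients in t of the formal solution exp (-t Laplacian) a at x. *)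
Definition heat_coef {R : realType} {V : choiceType} (G : weightedGraph R V)
  (a : V -> R) (x : V) (k : nat) : R :=
  (-1) ^+ k * iter k (laplacian G) a x / k`!%:R.

Lemma pseries_diffs_heat_coef (R : realType) (V : choiceType)
    (G : weightedGraph R V) (a : V -> R) (x : V) (k : nat) :
  pseries_diffs (heat_coef G a x) k =
    - ((-1) ^+ k / k`!%:R * iter k.+1 (laplacian G) a x).
Proof.
have kf : k`!%:R != 0 :> R by rewrite pnatr_eq0 -lt0n fact_gt0.
rewrite /pseries_diffs /heat_coef factS natrM exprS; field.
by rewrite kf nat1r pnatr_eq0.
Qed.

Lemma laplacian_pseries_heat_coef (R : realType) (V : choiceType)
    (G : weightedGraph R V) (a : V -> R) (t : R) (x : V) :
  (forall y, cvgn (pseries (heat_coef G a y) t)) ->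
  cvgn (pseries (pseries_diffs (heat_coef G a x)) t) ->
  laplacian G (fun y => limn (pseries (heat_coef G a y) t)) x =
    - limn (pseries (pseries_diffs (heat_coef G a x)) t).
Proof.
move=> cvgy cvgx.
have Lcvg := @laplacian_cvg _ _ G (fun n y => pseries (heat_coef G a y) t n)
  (fun y => limn (pseries (heat_coef G a y) t)) x cvgy.
rewrite -(cvg_lim _ Lcvg)//; apply: cvg_lim => //.
(* The identity already holds for partial sums of equal length: the factor k + 1 from
   differentiation cancels against (k + 1)!. *)
suff -> : (fun n => laplacian G (fun y => pseries (heat_coef G a y) t n) x) =
  - pseries (pseries_diffs (heat_coef G a x)) t by exact: cvgN cvgx.
apply/funext => n; rewrite fctE /pseries /series /= -sumrN.
have -> : (fun y => \sum_(0 <= k < n) heat_coef G a y k * t ^+ k) =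
    (fun y => \sum_(0 <= k < n)
       (-1) ^+ k / k`!%:R * t ^+ k * iter k (laplacian G) a y).
  by apply/funext => y; apply: eq_bigr => k _; rewrite /heat_coef; ring.
rewrite laplacian_sum; apply: eq_bigr => k _.
by rewrite pseries_diffs_heat_coef iterS; ring.
Qed.

(** Uniformity of M in x gives all vertices a common lifespan; C may vary with x. *)
Lemma backward_heat_solution_pseries (R : realType) (V : choiceType)
    (G : weightedGraph R V) (a C : V -> R) (M : R) :
  0 < M -> (forall x k, `|heat_coef G a x k| <= C x * M ^+ k) ->
  let u x t := limn (pseries (heat_coef G a x) t) in
  backward_heat_solution G a (8 * M)^-1 u /\
  (forall x t, 0 <= t < (8 * M)^-1 -> `|u x t| <= 2 * C x).
Proof.
move=> M0 coefM u; have M0' := ltW M0.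
have C0 x : 0 <= C x.
  by have := le_trans (normr_ge0 _) (coefM x 0%N); rewrite mulr1.
have Mt t : 0 <= t < (8 * M)^-1 -> `|t| < (8 * M)^-1 /\ M * `|t| <= 8^-1.
  move=> /andP[t0 tM]; rewrite ger0_norm//; split=> //.
  by have := ltW tM; rewrite invfM ler_pdivlMr// mulrC.
have cvgu x t : 0 <= t < (8 * M)^-1 ->
    cvgn (pseries (heat_coef G a x) t) /\ `|u x t| <= 2 * C x.
  move=> /Mt[_ Mt8]; apply: (cvg_pseries_geometric_bound (C0 x) M0' (coefM x)).
  lra.
split; last by move=> x t /(cvgu x)[].
split=> [x|x t tM].
  (* At t = 0 the partial sums are constant from n = 1 on, where the term k = 0 is included with 0^0
     = 1. *)
  apply: cvg_lim => //; apply: cvg_near_cst; exists 1%N => // n /= n1.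
  rewrite /pseries /series /= big_ltn// big_nat big1 ?addr0 => [|k /andP[k0 _]].
    by rewrite /heat_coef /= !mul1r fact0 divr1 mulr1.
  by rewrite expr0n gtn_eqF// mulr0.
have [tM' Mt8] := Mt t tM.
have CM0 : 0 <= C x * M by rewrite mulr_ge0.
have twoM0 : 0 <= 2 * M by rewrite mulr_ge0.
have diffsM := pseries_diffs_geometric_bound (C0 x) M0' (coefM x).
have twoMt : 2 * M * `|t| <= 2^-1 by lra.
have [cvgdiffs _] := cvg_pseries_geometric_bound CM0 twoM0 diffsM twoMt.
exists (limn (pseries (pseries_diffs (heat_coef G a x)) t)).
  exact: is_derive_time (is_derive_pseries (C0 x) M0 (coefM x) tM').
by rewrite laplacian_pseries_heat_coef ?subrr// => y; have [] := cvgu y t tM.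
Qed.

(** * The equivalence *)

Theorem corollary1p5 (R : realType) (V : choiceType) (G : weightedGraph R V)
    (G_connected : graph_connected G) (p : V) (a : V -> R) (D : R)
    (D_gt0 : 0 < D)
    (Deg_le : (ereal_sup [set (wdeg G x)%:E | x in [set: V]] <= D%:E)%E) :
  (exists delta A1 A2 : R,
     [/\ 0 < delta, 0 < A1, 0 < A2 < 1 &
      exists u : V -> R -> R,
        backward_heat_solution G a delta u /\
        (forall (x : V) (t : R), 0 <= t < delta ->
           `|u x t| <= A1 * expR (A2 * gdist G x p * ln (gdist G x p)))])
  <->
  (exists A3 A4 : R,
     [/\ 0 < A3, 0 < A4 < 1 &
      forall (x : V) (k : nat),
        `|iter k (laplacian G) a x| <=
          A3 * (2 * D) ^+ k *
          expR (A4 * (k%:R + gdist G x p) * ln (k%:R + gdist G x p))]).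
Proof.
have [N [gdistN Nadj]] := gdist_natfun p G_connected.
have degD x : wdeg G x <= D.
  by rewrite -lee_fin; apply: le_trans Deg_le; apply: ereal_sup_ubound; exists x.
split.
  move=> [delta [A1 [A2 [delta0 A10 /andP[A20 A21] [u [[ua _] ubound]]]]]].
  (* The bound at time 0 propagates to all iterates with the same constants. *)
  exists A1, A2; split; rewrite ?A20 ?A21// => x k.
  have Fmono : {homo (fun n => A1 * expR (A2 * (n%:R * ln n%:R))) :
      m n / (m <= n)%N >-> m <= n}.
    by move=> m n mn; rewrite ler_pM2l// ler_expR ler_pM2l// xlnx_nondecreasing.
  have aF y : `|a y| <= A1 * expR (A2 * ((N y)%:R * ln (N y)%:R)).
    rewrite -ua -gdistN mulrA; apply: ubound.
    by rewrite lexx.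
  have := iter_laplacian_bound (ltW D_gt0) degD Nadj Fmono aF k x.
  by rewrite natrD -gdistN mulrCA !mulrA.
move=> [A3 [A4 [A30 A401 aA]]]; have /andP[A40 A41] := A401.
(* The factor 2D comes from (ii), the other from [expR_xlnx_addn_le]. *)
pose M := 2 * D * expR (1 + ln 2).
have M0 : 0 < M by rewrite !mulr_gt0// expR_gt0.
pose C x := A3 * expR (ln 2 * (N x)%:R + A4 * ((N x)%:R * ln (N x)%:R)).
have coefM x k : `|heat_coef G a x k| <= C x * M ^+ k.
  have kf : 0 < k`!%:R :> R by rewrite ltr0n fact_gt0.
  rewrite /heat_coef !normrM normfV normrX normrN1 expr1n mul1r (gtr0_norm kf).
  rewrite ler_pdivrMr//; apply: (le_trans (aA x k)).
  rewrite gdistN -natrD -[A4 * _ * _]mulrA.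
  have := expR_xlnx_addn_le k (N x) A401.
  have AD : 0 < A3 * (2 * D) ^+ k by rewrite mulr_gt0 ?exprn_gt0 ?mulr_gt0.
  rewrite -(ler_pM2l AD) => /le_trans; apply.
  rewrite /C /M [X in _ <= _ * X * _]exprMn le_eqVlt; apply/orP; left.
  by apply/eqP; ring.
have [usol ubound] := backward_heat_solution_pseries M0 coefM.
(* Half the gap to 1, so that A4 + e = (1 + A4) / 2 is still below 1. *)
pose e := (1 - A4) / 2.
have e0 : 0 < e by rewrite /e; lra.
(* The leading 2 is the sum of the geometric series; the exponential is the constant of
   [linear_le_xlnx] at c = ln 2. *)
exists (8 * M)^-1, (2 * A3 * expR (ln 2 * expR (ln 2 / e))), (A4 + e).
split; first by rewrite invr_gt0 mulr_gt0.
- by rewrite !mulr_gt0// expR_gt0.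
- by rewrite /e; apply/andP; split; lra.
exists (fun x t => limn (pseries (heat_coef G a x) t)); split=> // x t tM.
apply: (le_trans (ubound x t tM)).
rewrite /C gdistN -!mulrA !ler_pM2l// -expRD ler_expR.
have := linear_le_xlnx (N x) e0 (ln_ge0 (ler1n R 2)).
lra.
Qed.
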